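(* When the infinity norm is chosen as the norm in the solution space $G=\mathbb R^k$, the condition number $\kappa_\infty$ of $g(A,b)=L^{\top}(A^{\top}\Sigma_{pq}A)^{-1}A^{\top}\Sigma_{pq}b$ at $(A,b)$ (componentwise norm on the data) is $$\kappa_\infty=\Big\|\sum_{j=1}^n\big|L^{\top}(A^{\top}\Sigma_{pq}A)^{-1}\big(e_j(\Sigma_{pq}r)^{\top}-x_jA^{\top}\Sigma_{pq}\big)\big|\,|A(:,j)|+|L^{\top}W|\,|b|\,\Big\|_\infty ,$$ where $e_j$ is the $j$th column of $I_n$.
   Context: Let $m\ge n$, $p+q=m$, $\Sigma_{pq}=\begin{pmatrix} I_p&0\\0&-I_q\end{pmatrix}$, $A=(a_{ij})\in\mathbb R^{m\times n}$, $b\in\mathbb R^m$, with $A^{\top}\Sigma_{pq}A$ positive definite (standing assumption). Let $x=(x_1,\dots,x_n)^{\top}=(A^{\top}\Sigma_{pq}A)^{-1}A^{\top}\Sigma_{pq}b$ be the solution of the indefinite least squares problem $\min_x(b-Ax)^{\top}\Sigma_{pq}(b-Ax)$, and $r=b-Ax$. Let $L\in\mathbb R^{n\times k}$, $k\le n$, be a fixed matrix, and $g(A,b)=L^{\top}(A^{\top}\Sigma_{pq}A)^{-1}A^{\top}\Sigma_{pq}b\in\mathbb R^k$, which is Fréchet differentiable near $(A,b)$, with derivative $g'(A,b)$. On the data space the componentwise norm relative to $(A,b)$ is used: $\|(\Delta A,\Delta b)\|_c=\min\{\omega\ge0:\ |\Delta a_{ij}|\le\omega|a_{ij}|,\ |\Delta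 b_i|\le\omega|b_i|\ \text{for all } i,j\}$ (equal to $+\infty$ if no such $\omega$ exists). Then $\kappa_\infty=\max_{\|(\Delta A,\Delta b)\|_c=1}\|g'(A,b)\cdot(\Delta A,\Delta b)\|_\infty$. Define $W=(A^{\top}\Sigma_{pq}A)^{-1}A^{\top}\Sigma_{pq}$. $A(:,j)$ is the $j$th column of $A$, and $|\cdot|$ of a matrix or vector is taken entrywise. *)

(* Defs.v *)
From HB Require Import structures.
From mathcomp Require Import all_boot all_order all_algebra.
From mathcomp Require Import all_classical all_reals all_analysis.

Set Implicit Arguments.
Unset Strict Implicit.
Unset Printing Implicit Defensive.

Import Order.TTheory GRing.Theory Num.Theory.
Import numFieldNormedType.Exports.

Local Open Scope classical_set_scope.
Local Open Scope ring_scope.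

Definition Sigma (R : realType) (p q : nat) : 'M[R]_(p + q) :=
  block_mx 1%:M 0 0 (- 1%:M).

Definition posdefmx (R : realType) (n : nat) (M : 'M[R]_n) : Prop :=
  M^T = M /\ forall v : 'cV[R]_n, v != 0 -> 0 < (v^T *m M *m v) ord0 ord0.

Definition absmx (R : realType) (m n : nat) (A : 'M[R]_(m, n)) : 'M[R]_(m, n) :=
  map_mx (fun a : R => `|a|) A.

Section IndefiniteLeastSquares.
Context {R : realType} {p q n : nat}.
Implicit Types (A : 'M[R]_(p + q, n)) (b : 'cV[R]_(p + q)).

Definition gram A : 'M[R]_n := A^T *m Sigma R p q *m A.

Definition ils_W A : 'M[R]_(n, p + q) := invmx (gram A) *m A^T *m Sigma R p q.

Definition ils_solution A b : 'cV[R]_n := ils_W A *m b.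

Definition ils_residual A b : 'cV[R]_(p + q) := b - A *m ils_solution A b.

Definition ils_map {k : nat} (L : 'M[R]_(n, k))
    (d : 'M[R]_(p + q, n) * 'cV[R]_(p + q)) : 'cV[R]_k :=
  L^T *m invmx (gram d.1) *m d.1^T *m Sigma R p q *m d.2.

End IndefiniteLeastSquares.

(* The set of admissible w is closed and bounded below by 0, so the infimum is
   a minimum when the set is nonempty; it is +oo when the set is empty. *)
Definition comp_norm (R : realType) (m n : nat)
    (d delta : 'M[R]_(m, n) * 'cV[R]_m) : \bar R :=
  ereal_inf [set w%:E | w in [set w : R |
    [/\ 0 <= w,
        forall i j, `|delta.1 i j| <= w * `|d.1 i j| &
        forall i, `|delta.2 i ord0| <= w * `|d.2 i ord0| ] ] ].

Definition is_max (R : realType) (S : set R) (v : R) : Prop :=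
  S v /\ ubound S v.

(* The library norm on matrices is the largest absolute value of an entry, i.e.
   the infinity norm on column vectors. Differentiability is required because
   the library differential is an arbitrary linear map otherwise. *)
Definition is_comp_cond_inf (R : realType) (m n k : nat)
    (g : 'M[R]_(m, n) * 'cV[R]_m -> 'cV[R]_k)
    (d : 'M[R]_(m, n) * 'cV[R]_m) (kappa : R) : Prop :=
  differentiable g d /\
  is_max [set `|'d g d delta| | delta in
           [set delta : 'M[R]_(m, n) * 'cV[R]_m | comp_norm d delta = 1%E]]
         kappa.

(* Main.v *)
Require Import Defs.
From HB Require Import structures.
From mathcomp Require Import all_boot all_order all_algebra.
From mathcomp Require Import all_classical all_reals all_analysis.

Import Order.TTheory GRing.Theory Num.Theory.
Import numFieldNormedType.Exports.
Local Open Scope classical_set_scope.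
Local Open Scope ring_scope.

(* With G = A^T S A, x the solution and r the residual at (A, b), the normal
   equation A^T S r = 0 gives, for d = (A + dA, b + db) and s = db - dA x,
     g(d) - g(A, b) = L^T G(d)^-1 (dA^T S r + A^T S s + dA^T S s),
   so continuity of the inverse alone yields differentiability, with
     g'(A, b)(dA, db) = L^T G^-1 (dA^T S r + A^T S (db - dA x)).
   Expanding this over the columns of dA bounds each of its entries by the
   corresponding entry of the vector in the formula; the bound for the largest
   entry is attained by giving the entries of (A, b) the signs of the
   coefficients in the row of that entry. *)

(** * Convergence of matrix operations along a filter, up to inversion *)

Section MatrixConvergence.
Context {K : numFieldType} {T : Type} {F : set_system T} {FF : Filter F}.

(** A neighbourhood of [M] contains a box of entrywise neighbourhoods, and a filter is stable under
    the finite intersection over all index pairs. *)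
Lemma cvg_mx {m n} (f : T -> 'M[K]_(m, n)) (M : 'M[K]_(m, n)) :
  (forall i j, f t i j @[t --> F] --> M i j) -> f @ F --> M.
Proof.
move=> cvgf X [P MP PX].
suff : F [set t | forall ij, P ij.1 ij.2 (f t ij.1 ij.2)].
  by apply: (@filterS _ F) => t Pt; apply: PX => i j; exact: Pt (i, j).
by apply: filter_forall => -[i j] /=; exact: cvgf (MP i j).
Qed.

Lemma cvg_coord {m n} {f : T -> 'M[K]_(m, n)} {M : 'M[K]_(m, n)} i j :
  f @ F --> M -> f t i j @[t --> F] --> M i j.
Proof.
move=> fM; apply: (cvg_comp f (fun N : 'M[K]_(m, n) => N i j) fM).
exact: coord_continuous.
Qed.

Lemma cvg_trmx {m n} (f : T -> 'M[K]_(m, n)) (M : 'M[K]_(m, n)) :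
  f @ F --> M -> (f t)^T @[t --> F] --> M^T.
Proof.
move=> fM; apply: cvg_mx => i j; rewrite mxE.
by under eq_cvg do rewrite mxE; exact: cvg_coord.
Qed.

Lemma cvg_sumr (I : Type) (r : seq I) (P : pred I) (f : I -> T -> K)
    (a : I -> K) :
  (forall i, P i -> f i @ F --> a i) ->
  \sum_(i <- r | P i) f i t @[t --> F] --> \sum_(i <- r | P i) a i.
Proof. by apply: cvg_big => //; exact: add_continuous. Qed.

Lemma cvg_prodr (I : Type) (r : seq I) (P : pred I) (f : I -> T -> K)
    (a : I -> K) :
  (forall i, P i -> f i @ F --> a i) ->
  \prod_(i <- r | P i) f i t @[t --> F] --> \prod_(i <- r | P i) a i.
Proof. by apply: cvg_big => //; exact: mul_continuous. Qed.

Lemma cvg_mulmx {m n l} (f : T -> 'M[K]_(m, n)) (g : T -> 'M[K]_(n, l))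
    (M : 'M[K]_(m, n)) (N : 'M[K]_(n, l)) :
  f @ F --> M -> g @ F --> N -> f t *m g t @[t --> F] --> M *m N.
Proof.
move=> fM gN; apply: cvg_mx => i j; rewrite mxE.
under eq_cvg do rewrite mxE.
by apply: cvg_sumr => l' _; apply: cvgM; exact: cvg_coord.
Qed.

Lemma cvg_det {n} (f : T -> 'M[K]_n) (M : 'M[K]_n) :
  f @ F --> M -> \det (f t) @[t --> F] --> \det M.
Proof.
move=> fM; apply: cvg_sumr => s _; apply: cvgM; first exact: cvg_cst.
by apply: cvg_prodr => i _; exact: cvg_coord.
Qed.

Lemma cvg_adjmx {n} (f : T -> 'M[K]_n) (M : 'M[K]_n) :
  f @ F --> M -> \adj (f t) @[t --> F] --> \adj M.
Proof.
move=> fM; apply: cvg_mx => i j; rewrite mxE.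
under eq_cvg do rewrite mxE.
apply: cvgM; first exact: cvg_cst.
apply: cvg_det; apply: cvg_mx => i' j'; rewrite !mxE.
by under eq_cvg do rewrite !mxE; exact: cvg_coord.
Qed.

Lemma near_unitmx {n} (f : T -> 'M[K]_n) (M : 'M[K]_n) :
  M \in unitmx -> f @ F --> M -> \forall t \near F, f t \in unitmx.
Proof.
rewrite unitmxE unitfE => M0 /cvg_det fM.
apply: filterS (cvgr_neq0 _ fM M0) => t.
by rewrite unitmxE unitfE.
Qed.

(** [invmx] is given by the adjugate formula on invertible matrices only and returns its argument
    elsewhere. As the determinant stays nonzero near the limit, the formula holds eventually, and
    its ingredients are polynomial in the entries. *)
Lemma cvg_invmx {n} (f : T -> 'M[K]_n) (M : 'M[K]_n) :
  M \in unitmx -> f @ F --> M -> invmx (f t) @[t --> F] --> invmx M.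
Proof.
move=> Mu fM.
have fu := near_unitmx _ _ Mu fM.
have -> : invmx M = (\det M)^-1 *: \adj M by rewrite /invmx Mu.
have ft : {near F, (fun t => (\det (f t))^-1 *: \adj (f t)) =1
    (fun t => invmx (f t))}.
  by apply: filterS fu => t ut; rewrite /invmx ut.
apply: cvg_trans (near_eq_cvg ft) _.
apply: cvgZ; last exact: cvg_adjmx.
by apply: cvgV; [rewrite -unitfE -unitmxE|exact: cvg_det].
Qed.

End MatrixConvergence.

(** * The largest-entry norm, and invertibility of positive definite matrices *)

Section MatrixNorm.
Context {R : realType}.

Lemma mx_norm_leP {m n} (M : 'M[R]_(m, n)) (c : R) : 0 <= c ->
  `|M| <= c <-> forall i j, `|M i j| <= c.
Proof.
move=> c0; rewrite [leLHS]/Num.Def.normr/= mx_normrE; split.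
  by move=> /bigmax_leP[_ Mc] i j; exact: Mc (i, j) isT.
by move=> Mc; apply/bigmax_leP; split.
Qed.

Lemma le_coord_mx_norm {m n} (M : 'M[R]_(m, n)) i j : `|M i j| <= `|M|.
Proof. exact: (mx_norm_leP M `|M| (normr_ge0 _)).1. Qed.

Lemma mx_norm_mulmx_le {m n l} (M : 'M[R]_(m, n)) (N : 'M[R]_(n, l)) :
  `|M *m N| <= n%:R * (`|M| * `|N|).
Proof.
apply/mx_norm_leP => [|i j]; first by rewrite !mulr_ge0.
rewrite mxE (le_trans (ler_norm_sum _ _ _))//.
rewrite mulr_natl -[leRHS](_ : \sum_(i < n) `|M| * `|N| = _); last first.
  by rewrite sumr_const card_ord.
by apply: ler_sum => k _; rewrite normrM ler_pM ?le_coord_mx_norm.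
Qed.

Lemma mx_norm_trmx_le {m n} (M : 'M[R]_(m, n)) : `|M^T| <= `|M|.
Proof.
by apply/mx_norm_leP => // i j; rewrite mxE; exact: le_coord_mx_norm.
Qed.

(** Positivity excludes the empty vector, whose norm is 0 although it has no entry. *)
Lemma mx_norm_gt0_coord {m} (v : 'cV[R]_m) :
  0 < `|v| -> exists i, `|v| = `|v i ord0|.
Proof.
move=> v0; have [] := @mx_norm_neq0 _ _ _ v; first by rewrite lt0r_neq0.
by move=> [i j] /=; rewrite (ord1 j); exists i.
Qed.

(** A row [v] with [v *m M = 0] makes the quadratic form vanish at [v^T], hence is zero. *)
Lemma posdefmx_unitmx {n} (M : 'M[R]_n) : posdefmx M -> M \in unitmx.
Proof.
move=> [_ Mpos]; rewrite -row_free_unit; apply: inj_row_free => v vM.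
apply/eqP; apply: contraPT (vM) => v0 _.
have := Mpos v^T; rewrite trmxK vM mul0mx mxE ltxx => /(_ _)/notF; apply.
by rewrite -(inj_eq trmx_inj) trmxK trmx0.
Qed.

End MatrixNorm.

Lemma mulmx_sum_col {K : comNzRingType} {m n} (M : 'M[K]_(m, n))
    (u : 'cV[K]_n) :
  M *m u = \sum_(j < n) u j ord0 *: col j M.
Proof.
apply/colP => i; rewrite mxE summxE; apply: eq_bigr => j _.
by rewrite !mxE mulrC.
Qed.

(** In row i only the term j = i survives, and it is the scalar product of [u] with column i of [M].
    This produces the e_j of the final formula. *)
Lemma trmx_mul_sum_delta {K : comNzRingType} {m n} (M : 'M[K]_(m, n))
    (u : 'cV[K]_m) :
  M^T *m u = \sum_(j < n) delta_mx j ord0 *m u^T *m col j M.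
Proof.
apply/colP => i; rewrite summxE (bigD1 i)//= big1 => [|j ji].
  rewrite addr0 -mulmxA !mxE big_ord1 mxE !eqxx mul1r mxE.
  apply: eq_bigr => l _.
  by rewrite !mxE mulrC.
by rewrite -mulmxA mxE big_ord1 mxE eq_sym (negbTE ji) mul0r.
Qed.

(** * Differentiability of the solution map and its derivative by columns *)

Section Differential.
Context {R : realType} {p q n k : nat}.
Variables (L : 'M[R]_(n, k)) (A : 'M[R]_(p + q, n)) (b : 'cV[R]_(p + q)).
Implicit Types h : 'M[R]_(p + q, n) * 'cV[R]_(p + q).

Let S := Sigma R p q.
Let x := ils_solution A b.
Let r := ils_residual A b.

Definition ils_diff h : 'cV[R]_k :=
  L^T *m invmx (gram A) *m (h.1^T *m S *m r + A^T *m S *m (h.2 - h.1 *m x)).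

Lemma ils_diff_is_linear : linear ils_diff.
Proof.
move=> a u v; rewrite /ils_diff/= scalemxAr -mulmxDr; congr (_ *m _).
rewrite linearP/= !mulmxDl -!scalemxAl opprD addrACA -scalerBr.
by rewrite (mulmxDr (A^T *m S)) -scalemxAr scalerDr [RHS]addrACA.
Qed.

HB.instance Definition _ :=
  GRing.isLinear.Build R _ _ _ ils_diff ils_diff_is_linear.

Hypothesis Au : gram A \in unitmx.

Lemma ils_normal_equation : A^T *m S *m r = 0.
Proof.
have -> : A^T *m S *m r = A^T *m S *m b - gram A *m x.
  by rewrite /r /ils_residual mulmxBr !mulmxA.
rewrite /x /ils_solution /ils_W -[invmx _ *m _ *m _]mulmxA.
by rewrite -[invmx _ *m _ *m _]mulmxA (mulKVmx Au) subrr.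
Qed.

(** With B = A + dA, write x as G(B)^-1 (G(B) x). The increment becomes L^T G(B)^-1 B^T S (b + db -
    B x), where b + db - B x = r + s. Expanding B^T, the term A^T S r drops out by the normal
    equation. *)
Lemma ils_map_increment h : gram (A + h.1) \in unitmx ->
  ils_map L ((A, b) + h) - ils_map L (A, b) =
  L^T *m invmx (gram (A + h.1)) *m
    (h.1^T *m S *m r + A^T *m S *m (h.2 - h.1 *m x) +
     h.1^T *m (S *m (h.2 - h.1 *m x))).
Proof.
move=> Bu; rewrite /ils_map/=; set B := A + h.1.
have -> : L^T *m invmx (gram A) *m A^T *m Sigma R p q *m b =
    L^T *m invmx (gram B) *m (gram B *m x).
  rewrite -(mulmxA _ (invmx (gram B))) (mulKmx Bu).
  by rewrite /x /ils_solution /ils_W !mulmxA.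
have -> : L^T *m invmx (gram B) *m B^T *m Sigma R p q *m (b + h.2) =
    L^T *m invmx (gram B) *m (B^T *m (S *m (b + h.2))) by rewrite !mulmxA.
rewrite -mulmxBr; congr (_ *m _).
rewrite /gram -!mulmxA -!mulmxBr.
have -> : b + h.2 - B *m x = r + (h.2 - h.1 *m x).
  by rewrite /r /ils_residual /B mulmxDl opprD addrACA.
have := ils_normal_equation; rewrite -mulmxA.
move: (r) (h.2 - h.1 *m x) => r' s r0.
rewrite /B linearD/= mulmxDl !mulmxDr r0 add0r.
by rewrite addrA (addrC (A^T *m _)).
Qed.

Lemma continuous_ils_diff : continuous ils_diff.
Proof.
move=> h; apply: cvg_mulmx; first exact: cvg_cst.
apply: cvgD.
  apply: cvg_mulmx; last exact: cvg_cst.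
  apply: cvg_mulmx; last exact: cvg_cst.
  by apply: cvg_trmx; exact: cvg_fst.
apply: cvg_mulmx; first exact: cvg_cst.
apply: cvgB; first exact: cvg_snd.
by apply: cvg_mulmx; [exact: cvg_fst|exact: cvg_cst].
Qed.

Let V : normedModType R := ('M[R]_(p + q, n) * 'cV[R]_(p + q))%type.
Let f : V -> 'cV[R]_k := ils_map L.
Let df : {linear V -> 'cV[R]_k} := ils_diff.

(** The remainder is (E h - E0) l h + E h (dA^T S s). Each summand is a factor of order |h| times
    one that tends to 0: E h - E0 in the first, S s in the second. *)
Lemma ils_map_expansion :
  f \o shift ((A, b) : V) = cst (f (A, b)) + df +o_ (0 : V) id.
Proof.
pose E h := L^T *m invmx (gram (A + h.1)).
pose E0 := L^T *m invmx (gram A).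
pose s h := h.2 - h.1 *m x.
pose l h := h.1^T *m S *m r + A^T *m S *m s h.
pose m := (p + q)%N.
(* [C] bounds |l h| / |h|: |s h| is at most (1 + n |x|) |h|, and each matrix product costs a factor
   equal to its inner dimension. *)
pose C := m%:R * `|S *m r| + m%:R * (`|A^T *m S| * (1 + n%:R * `|x|)).
(* [psi h * |h|] dominates the remainder, so it suffices that [psi] tends to 0. *)
pose psi h := n%:R * (`|E h - E0| * C) + n%:R * (`|E h| * (m%:R * `|S *m s h|)).
have cvg1 : h.1 @[h --> (0 : V)] --> (0 : 'M[R]_(p + q, n)).
  exact: cvg_fst.
have cvgA : A + h.1 @[h --> (0 : V)] --> A.
  by rewrite -[X in _ --> X]addr0; apply: cvgD => //; exact: cvg_cst.
have cvg_gram : gram (A + h.1) @[h --> (0 : V)] --> gram A.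
  apply: cvg_mulmx => //; apply: cvg_mulmx; last exact: cvg_cst.
  exact: cvg_trmx.
have cvgE : E h @[h --> (0 : V)] --> E0.
  by apply: cvg_mulmx; [exact: cvg_cst|exact: cvg_invmx].
have cvgs : s h @[h --> (0 : V)] --> (0 : 'cV[R]_(p + q)).
  have -> : (0 : 'cV[R]_(p + q)) = 0 - (0 : 'M[R]_(p + q, n)) *m x.
    by rewrite mul0mx subr0.
  apply: cvgB; first exact: cvg_snd.
  by apply: cvg_mulmx => //; exact: cvg_cst.
have psi0 : psi h @[h --> (0 : V)] --> 0.
  have -> : 0 = n%:R * (`|E0 - E0| * C)
             + n%:R * (`|E0| * (m%:R * `|S *m (0 : 'cV[R]_(p + q))|)).
    by rewrite subrr mulmx0 !normr0 !(mul0r, mulr0) addr0.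
  apply: cvgD; (apply: cvgM; first exact: cvg_cst).
    apply: cvgM; last exact: cvg_cst.
    by apply: cvg_norm; apply: cvgB => //; exact: cvg_cst.
  apply: cvgM; first exact: cvg_norm.
  apply: cvgM; first exact: cvg_cst.
  by apply: cvg_norm; apply: cvg_mulmx => //; exact: cvg_cst.
apply/eqaddoP => _/posnumP[e].
have psi_le : \forall h \near (0 : V), psi h <= e%:num.
  by apply: cvgr_le psi0 _ _.
have near_unit := near_unitmx _ _ Au cvg_gram.
near=> h.
have psi_h : psi h <= e%:num by near: h; exact: psi_le.
have Bu : gram (A + h.1) \in unitmx.
  by near: h; exact: near_unit.
have h1 : `|h.1| <= `|h| by rewrite prod_normE le_max lexx.
have h2 : `|h.2| <= `|h| by rewrite prod_normE le_max lexx orbT.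
have lh : `|l h| <= C * `|h|.
  have sh : `|s h| <= (1 + n%:R * `|x|) * `|h|.
    rewrite mulrDl mul1r (le_trans (ler_normB _ _))// lerD//.
    rewrite (le_trans (mx_norm_mulmx_le _ _))// -mulrA ler_wpM2l//.
    by rewrite mulrC ler_wpM2l.
  rewrite mulrDl (le_trans (ler_normD _ _))// lerD//.
    rewrite -mulmxA (le_trans (mx_norm_mulmx_le _ _))// -mulrA ler_wpM2l//.
    by rewrite mulrC ler_wpM2l// (le_trans (mx_norm_trmx_le _)).
  rewrite (le_trans (mx_norm_mulmx_le _ _))// -!mulrA ler_wpM2l//.
  by rewrite ler_wpM2l.
have -> : (f \o shift ((A, b) : V) - (cst (f (A, b)) + df)) h =
    (E h - E0) *m l h + E h *m (h.1^T *m (S *m s h)).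
  rewrite !fctE/= opprD addrA (addrC h) ils_map_increment// /ils_diff.
  by rewrite -/(s h) -/(l h) -/(E h) -/E0 mulmxDr mulmxBl addrAC.
rewrite (le_trans (ler_normD _ _))//.
apply: (@le_trans _ _ (psi h * `|h|)); last by rewrite ler_wpM2r.
rewrite /psi mulrDl lerD//.
  rewrite (le_trans (mx_norm_mulmx_le _ _))// -!mulrA ler_wpM2l//.
  by rewrite ler_wpM2l.
rewrite (le_trans (mx_norm_mulmx_le _ _))// -!mulrA ler_wpM2l// ler_wpM2l//.
rewrite (le_trans (mx_norm_mulmx_le _ _))// ler_wpM2l//.
by rewrite mulrC ler_wpM2l// (le_trans (mx_norm_trmx_le _)).
Unshelve. all: by end_near. Qed.

(** The expansion with a continuous linear part determines the differential, so ['d] is identified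
    with [df] by uniqueness. *)
Lemma is_diff_ils_map : is_diff ((A, b) : V) f df.
Proof.
have dfE := diff_unique continuous_ils_diff ils_map_expansion.
apply: DiffDef => //; apply/diff_locallyP; rewrite dfE.
by split; [exact: continuous_ils_diff|exact: ils_map_expansion].
Qed.

Definition ils_column_coef (j : 'I_n) : 'M[R]_(k, p + q) :=
  L^T *m invmx (gram A) *m
    (delta_mx j ord0 *m (S *m r)^T - x j ord0 *: (A^T *m S)).

(** Both dA^T S r and dA x are expanded over the columns of dA; collecting the coefficient of column
    j gives the matrix under the absolute value in the formula. *)
Lemma ils_diff_columns h : ils_diff h =
  \sum_(j < n) ils_column_coef j *m col j h.1 + L^T *m ils_W A *m h.2.
Proof.
rewrite /ils_diff /ils_column_coef; move: (x) (r) => x' r'.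
under eq_bigr do rewrite -mulmxA mulmxBl.
rewrite -mulmx_sumr sumrB -trmx_mul_sum_delta.
under eq_bigr do rewrite -scalemxAl scalemxAr.
rewrite -mulmx_sumr -mulmx_sum_col.
have -> : L^T *m ils_W A *m h.2 = L^T *m invmx (gram A) *m (A^T *m S *m h.2).
  by rewrite /ils_W !mulmxA.
rewrite -mulmxDr; congr (_ *m _).
by rewrite -mulmxA mulmxBr addrA addrAC.
Qed.

End Differential.

(** Passes from factors below every c > 1 to the factor 1, as needed for an infimum equal to 1. If
    |a| > |b| > 0, the choice c = |a| / |b| is contradictory; if b = 0, any c gives a = 0. *)
Lemma ler_norm_of_ratio {R : realFieldType} (a b : R) :
  (forall c, 1 < c -> exists2 w, w < c & `|a| <= w * `|b|) -> `|a| <= `|b|.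
Proof.
move=> ab; have [b0|b0] := eqVneq b 0.
  by have [w _] := ab 2 (ltr1n _ 2); rewrite b0 normr0 mulr0.
rewrite leNgt; apply/negP => ba; have b_gt0 : 0 < `|b| by rewrite normr_gt0.
have [|w wab] := ab (`|a| / `|b|); first by rewrite ltr_pdivlMr// mul1r.
by rewrite leNgt -ltr_pdivlMr// wab.
Qed.

(** * Data perturbations of componentwise norm 1 *)

Section ComponentwiseNorm.
Context {R : realType} {m n : nat}.
Implicit Types d delta : 'M[R]_(m, n) * 'cV[R]_m.

Lemma comp_norm_lt d delta (c : R) : (comp_norm d delta < c%:E)%E ->
  exists2 w : R, w < c &
    (forall i j, `|delta.1 i j| <= w * `|d.1 i j|) /\
    (forall i, `|delta.2 i ord0| <= w * `|d.2 i ord0|).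
Proof.
by move=> /ereal_inf_lt[_ [w [_ ? ?] <-]]; rewrite lte_fin; exists w.
Qed.

Lemma comp_norm_eq1_le d delta : comp_norm d delta = 1%E ->
  (forall i j, `|delta.1 i j| <= `|d.1 i j|) /\
  (forall i, `|delta.2 i ord0| <= `|d.2 i ord0|).
Proof.
move=> d1; split=> [i j|i]; apply: ler_norm_of_ratio => c c1;
  have [|w wc [dA db]] := comp_norm_lt d delta c; rewrite ?d1 ?lte_fin//;
  by exists w.
Qed.

(** The factor 1 is admissible, and the nonzero entry of the data forces every admissible factor to
    be at least 1. *)
Lemma comp_norm_eq1 d delta i0 j0 : d.1 i0 j0 != 0 ->
  (forall i j, `|delta.1 i j| = `|d.1 i j|) ->
  (forall i, `|delta.2 i ord0| = `|d.2 i ord0|) -> comp_norm d delta = 1%E.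
Proof.
move=> d0 dA db; apply/eqP; rewrite eq_le; apply/andP; split.
  apply: ereal_inf_lbound; exists 1 => //.
  by split=> // [i j|i]; rewrite mul1r ?dA ?db.
apply/ereal_infP => _ [w [_ wA _] <-].
by rewrite lee_fin; have := wA i0 j0; rewrite dA ler_pMl ?normr_gt0.
Qed.

End ComponentwiseNorm.

(** Unlike the sign of c times |a|, this keeps the modulus of a even when c = 0, so that aligned
    data still have componentwise norm 1. *)
Definition sign_align {R : realType} (c a : R) : R :=
  if 0 <= c * a then a else - a.

Lemma norm_sign_align {R : realType} (c a : R) : `|sign_align c a| = `|a|.
Proof. by rewrite /sign_align; case: ifP; rewrite ?normrN. Qed.

Lemma mul_sign_align {R : realType} (c a : R) :
  c * sign_align c a = `|c| * `|a|.
Proof.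
rewrite -normrM /sign_align; case: ifPn => [/ger0_norm//|].
by rewrite -ltNge mulrN => /ltr0_norm.
Qed.

(** * Maximum of a linear map over perturbations of componentwise norm 1 *)

Section LinearMapMax.
Context {R : realType} {m n k : nat}.
Variables (B : 'I_n -> 'M[R]_(k, m)) (C : 'M[R]_(k, m)).
Variables (A : 'M[R]_(m, n)) (b : 'cV[R]_m).

Let g (h : 'M[R]_(m, n) * 'cV[R]_m) : 'cV[R]_k :=
  \sum_(j < n) B j *m col j h.1 + C *m h.2.
Let v : 'cV[R]_k :=
  \sum_(j < n) absmx (B j) *m absmx (col j A) + absmx C *m absmx b.

Lemma coord_columns_map h i :
  g h i ord0 =
  \sum_(j < n) \sum_l B j i l * h.1 l j + \sum_l C i l * h.2 l ord0.
Proof.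
rewrite /g mxE summxE mxE; congr (_ + _); apply: eq_bigr => j _.
by rewrite mxE; apply: eq_bigr => l _; rewrite mxE.
Qed.

Lemma coord_columns_abs i :
  v i ord0 =
  \sum_(j < n) \sum_l `|B j i l| * `|A l j| + \sum_l `|C i l| * `|b l ord0|.
Proof.
rewrite /v mxE summxE mxE; congr (_ + _); apply: eq_bigr => j _.
  by rewrite mxE; apply: eq_bigr => l _; rewrite !mxE.
by rewrite !mxE.
Qed.

Lemma columns_map_le h : comp_norm (A, b) h = 1%E -> `|g h| <= `|v|.
Proof.
move=> /comp_norm_eq1_le[/= hA hb]; apply/mx_norm_leP => // i j.
rewrite (ord1 j) (le_trans _ (le_coord_mx_norm v i ord0))//.
rewrite (le_trans _ (ler_norm _))// coord_columns_map coord_columns_abs.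
rewrite (le_trans (ler_normD _ _))// lerD//.
  rewrite (le_trans (ler_norm_sum _ _ _))//; apply: ler_sum => j' _.
  rewrite (le_trans (ler_norm_sum _ _ _))//; apply: ler_sum => l _.
  by rewrite normrM ler_wpM2l.
rewrite (le_trans (ler_norm_sum _ _ _))//; apply: ler_sum => l _.
by rewrite normrM ler_wpM2l.
Qed.

Lemma is_max_columns_map : A != 0 ->
  is_max [set `|g h| | h in [set h | comp_norm (A, b) h = 1%E]] `|v|.
Proof.
move=> A0; have [i0 [j0 Aij]] : exists i j, A i j != 0.
  apply: contrapT => nA; move/eqP: A0; apply; apply/matrixP => i j.
  by rewrite mxE; apply/eqP/negPn/negP => Aij; apply: nA; exists i, j.
split; last by move=> _ [h h1 <-]; exact: columns_map_le.
(* If [v] has norm 0, possibly because k = 0, there may be no row to select; the upper bound is then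
   0 and the data itself attains it. *)
have [v0|/mx_norm_gt0_coord[i vi]] := leP `|v| 0.
  have h1 : comp_norm (A, b) (A, b) = 1%E by exact: (comp_norm_eq1 _ _ i0 j0).
  exists (A, b) => //; apply/eqP; rewrite eq_le columns_map_le//=.
  by rewrite (le_trans v0).
(* Row i realizes the norm of [v]. Aligning the data with the coefficients of that row makes each
   product in it nonnegative, so that entry i of [g h] equals that of [v]. *)
pose h := (\matrix_(l, j) sign_align (B j i l) (A l j),
           \col_l sign_align (C i l) (b l ord0)).
have h1 : comp_norm (A, b) h = 1%E.
  by apply: (comp_norm_eq1 _ _ i0 j0) => //= *; rewrite mxE norm_sign_align.
exists h => //; apply/eqP; rewrite eq_le columns_map_le//= vi.
rewrite (le_trans _ (le_coord_mx_norm (g h) i ord0))//.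
rewrite coord_columns_map coord_columns_abs.
under [in leRHS]eq_bigr do under eq_bigr do rewrite mxE mul_sign_align.
by under [X in _ <= `|_ + X|]eq_bigr do rewrite mxE mul_sign_align.
Qed.

End LinearMapMax.

Theorem corollary2 (R : realType) (p q n k : nat)
    (A : 'M[R]_(p + q, n)) (b : 'cV[R]_(p + q)) (L : 'M[R]_(n, k))
    (n_gt0 : (0 < n)%N) (le_n_m : (n <= p + q)%N) (le_k_n : (k <= n)%N)
    (posdef : posdefmx (A^T *m Sigma R p q *m A)) :
  let x := ils_solution A b in
  let r := ils_residual A b in
  is_comp_cond_inf (ils_map L) (A, b)
    `| \sum_(j < n)
         absmx (L^T *m invmx (A^T *m Sigma R p q *m A) *m
                (delta_mx j ord0 *m (Sigma R p q *m r)^T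
                 - x j ord0 *: (A^T *m Sigma R p q)))
           *m absmx (col j A)
       + absmx (L^T *m ils_W A) *m absmx b |.
Proof.
move=> x r; have Au : gram A \in unitmx := posdefmx_unitmx _ posdef.
have [gdiff gE] := is_diff_ils_map L A b Au.
split=> //.
(* For A = 0 the quadratic form would vanish at the all-ones vector, which is nonzero because n >
   0. *)
have A0 : A != 0.
  apply/eqP => A0; have [_ /(_ (const_mx 1))] := posdef.
  rewrite A0 mulmx0 mulmx0 mul0mx mxE ltxx => /(_ _)/notF; apply.
  apply/eqP => /matrixP/(_ (Ordinal n_gt0) ord0); rewrite !mxE.
  by move/eqP; rewrite oner_eq0.
(* For these coefficients the vector [v] of the lemma is, up to unfolding, the vector in the
   formula. *)
have [[h h1 gh] ub] :=
  is_max_columns_map (ils_column_coef L A b) (L^T *m ils_W A) A b A0.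
split=> [|_ [h' h1' <-]].
  by exists h => //; rewrite gE -gh; congr `| _ |; exact: ils_diff_columns.
apply: ub; exists h' => //.
by rewrite gE; congr `| _ |; rewrite -ils_diff_columns.
Qed.
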